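(* In the general cut-and-choose setting described in the context (Protocol 2), assume $N\ge1$. Let $\varepsilon_H,\varepsilon_D\ge0$ be such that, for input $\psi=|+\rangle\langle+|^{\otimes k}$ and $U=\mathbb{1}_{\mathcal{X}}$, $$\tfrac12\|\rho_H-|+\rangle\langle+|^{\otimes k}\|_1\le\varepsilon_H$$ and, for every $\alpha\in\mathbb{R}$ (attack placement fixed), $$\min_{p\in[0,1]}\tfrac12\big\|\rho^\alpha_D-(p|+\rangle\langle+|^{\otimes k}+(1-p)|\bot\rangle\langle\bot|)\big\|_1\le\varepsilon_D .$$ Then $\varepsilon_H+\varepsilon_D\ge\frac{1}{4N}$.
   Context: General cut-and-choose setting. Fix $k\ge1$, $\mathcal{X}=\mathbb{C}^{2^k}$, $P(\alpha)=\mathrm{diag}(1,e^{i\alpha})$, $A_\alpha=\mathbb{1}_2^{\otimes(k-1)}\otimes P(\alpha)$, $|+\rangle=(|0\rangle+|1\rangle)/\sqrt2$, $|+_\alpha\rangle=(|0\rangle+e^{i\alpha}|1\rangle)/\sqrt2$. Let $\Omega$ be a probability distribution on $\mathbb{N}$ (number $n$ of test rounds) with finite mean $N$, and $\omega_n$ a distribution on $\{1,\dots,n+1\}$ (output round $\ell$). For each $n$ there are test unitaries $T_1,\dots,T_n\in\mathrm{U}(\mathcal{X})$. For each $(n,\ell)$: an integer $W$, an auxiliary space $\mathcal{Y}$, a test state $\chi_n$ on $\mathcal{X}^{\otimes W}\otimes\mathcal{Y}$, an accept operator $0\le\mu_{n,k,\ell}\le\mathbb{1}$ on $\mathcal{X}^{\otimes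 W}\otimes\mathcal{Y}$, and an $n$-comb $\mathfrak{B}(V_1,\dots,V_n)=\mathcal{E}_n\circ(\mathcal{V}_n\otimes\mathrm{id})\circ\mathcal{E}_{n-1}\circ\cdots\circ\mathcal{E}_1\circ(\mathcal{V}_1\otimes\mathrm{id})\circ\mathcal{E}_0$ (fixed channels $\mathcal{E}_j$ with memory, $\mathcal{V}_i(\rho)=V_i\rho V_i^\dagger$) producing a channel on $\mathcal{X}^{\otimes W}$. The client's computation round uses a separate register; on acceptance the client outputs the computation output, otherwise $|\bot\rangle$, a unit vector orthogonal to $\mathcal{X}$. The phase attack replaces each $T_i$ by $T^\alpha_i=T_iA_\alpha$ (all $i$) or $T^\alpha_i=A_\alpha T_i$ (all $i$), and likewise applies $A_\alpha$ in the computation round. With $p^H_{n,\ell}=\mathrm{Tr}[\mu_{n,k,\ell}(\mathfrak{B}(T_1,\dots,T_n)\otimes\mathrm{id}_\mathcal{Y})(\chi_n)]$, $p^D_{n,\ell}$ the same with $T^\alpha_i$, $p_H=\sum_n\Omega(n)\sum_\ell\omega_n(\ell)p^H_{n,\ell}$, $p^\alpha_D=\sum_n\Omega(n)\sum_\ell\omega_n(\ell)p^D_{n,\ell}$, the client's outputs for input $|+\rangle\langle+|^{\otimes k}$, $U=\mathbb{1}$ are $\rho_H=p_H|+\rangle\langle+|^{\otimes k}+(1-p_H)|\bot\rangle\langle\bot|$ and $\rho^\alpha_D=p^\alpha_D|+\rangle\langle+|^{\otimes(k-1)}\otimes|+_\alpha\rangle\langle+_\alpha|+(1-p^\alpha_D)|\bot\rangle\langle\bot|$.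 The trace-distance conditions are implied by composable $\varepsilon_H$-correctness and $\varepsilon_D$-security with respect to the ideal VDQC resource (output $U(\psi)$ if the server's bit $c=0$, $\bot$ if $c=1$). *)

(* Defs.v *)
From HB Require Import structures.
From mathcomp Require Import all_boot all_order all_algebra.
From mathcomp Require Import complex mxtens.
From mathcomp Require Import all_classical all_reals all_analysis.

Set Implicit Arguments.
Unset Strict Implicit.
Unset Printing Implicit Defensive.

Import Order.TTheory GRing.Theory Num.Theory.
Import numFieldNormedType.Exports.
Local Open Scope ring_scope.

Section QuantumDefs.
Variable R : realType.
Local Notation C := (complex R).

Definition toC (x : R) : C := Complex x 0.

Definition adj {m n} (A : 'M[C]_(m, n)) : 'M[C]_(n, m) := map_mx Num.conj (A^T).

Definition unitary {n} (U : 'M[C]_n) : Prop := adj U *m U = 1%:M.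

Definition psd {n} (A : 'M[C]_n) : Prop :=
  adj A = A /\ forall v : 'cV[C]_n, 0 <= (adj v *m A *m v) 0 0.

Definition density {n} (rho : 'M[C]_n) : Prop := psd rho /\ \tr rho = 1.

(* A quantum channel C^a -> C^b, given by a list of Kraus operators;
   trace preservation: sum_j K_j^dagger K_j = 1. *)
Definition is_channel {a b} (Ks : seq 'M[C]_(b, a)) : Prop :=
  \sum_(K <- Ks) adj K *m K = 1%:M.

Definition apply_chan {a b} (Ks : seq 'M[C]_(b, a)) (rho : 'M[C]_a) : 'M[C]_b :=
  \sum_(K <- Ks) K *m rho *m adj K.

(* Trace norm ||A||_1 = Tr sqrt(A^dagger A) = sum of singular values:
   sum of sqrt of the eigenvalues (with multiplicity) of A^dagger A. *)
Definition eigenvalues {n} (B : 'M[C]_n) : seq C :=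
  projT1 (closed_field_poly_normal (char_poly B)).

Definition trnorm {n} (A : 'M[C]_n) : C :=
  \sum_(z <- eigenvalues (adj A *m A)) sqrtC z.

Definition plus1 : 'M[C]_2 := const_mx (toC (1 / 2)).
Definition plusk (k : nat) : 'M[C]_(2 ^ k) := plus1 ^t k.

Definition phase (al : R) : 'M[C]_2 :=
  \matrix_(i < 2, j < 2)
    (if (i == j) then (if i == 1 :> nat then Complex (cos al) (sin al) else 1)
     else 0).

(* A_alpha = 1_2^{(k-1)} (x) P(alpha)  (k >= 1; the identity for k = 0,
   a case excluded in the theorem) *)
Definition Aalpha (k : nat) (al : R) : 'M[C]_(2 ^ k) :=
  match k return 'M[C]_(2 ^ k) with
  | 0 => 1%:M
  | k'.+1 => castmx (esym (expnSr 2 k'), esym (expnSr 2 k'))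
                    ((1%:M : 'M[C]_(2 ^ k')) *t phase al)
  end.

(* The client output on X (+) C|bot> : p sigma + (1-p) |bot><bot|,
   the last basis vector being |bot>. *)
Definition out_state (k : nat) (p : R) (sigma : 'M[C]_(2 ^ k)) : 'M[C]_(2 ^ k + 1) :=
  block_mx (toC p *: sigma) 0 0 ((toC (1 - p))%:M).

(* Data of the general cut-and-choose protocol (Protocol 2).
   n = number of test rounds, l = output round.
   T n i : the test unitaries T_1..T_n for n rounds.
   For each (n,l): W, dim Y, chi, mu, and an n-comb
     E_end o (E_mid (n-1)) o (V_n (x) id) o ... o E_mid 0 o (V_1 (x) id) o E_0
   with memory spaces M_j of dimension mem n l j (channels acting on
   X (x) M_j). *)
Record setting (k : nat) := Setting {
  Omega : nat -> R;
  omega : nat -> nat -> R;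
  T : nat -> nat -> 'M[C]_(2 ^ k);
  W : nat -> nat -> nat;
  dY : nat -> nat -> nat;
  mem : nat -> nat -> nat -> nat;
  chi : forall n l, 'M[C]_((2 ^ k) ^ W n l * dY n l);
  mu : forall n l, 'M[C]_((2 ^ k) ^ W n l * dY n l);
  E0 : forall n l, seq 'M[C]_(2 ^ k * mem n l 0, (2 ^ k) ^ W n l);
  Emid : forall n l j, seq 'M[C]_(2 ^ k * mem n l j.+1, 2 ^ k * mem n l j);
  Eend : forall n l, seq 'M[C]_((2 ^ k) ^ W n l, 2 ^ k * mem n l n)
}.

Definition valid_setting k (S : setting k) : Prop :=
  (forall n, 0 <= Omega S n) /\
  cvgn (series (Omega S) : nat -> R) /\ limn (series (Omega S) : nat -> R) = 1 /\
  cvgn (series (fun n => n%:R * Omega S n) : nat -> R) /\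
  (forall n, (forall l, (1 <= l <= n.+1)%N -> 0 <= omega S n l) /\
             \sum_(1 <= l < n.+2) omega S n l = 1) /\
  (forall n i, (1 <= i <= n)%N -> unitary (T S n i)) /\
  (forall n l, (1 <= l <= n.+1)%N ->
     density (chi S n l) /\ psd (mu S n l) /\ psd (1%:M - mu S n l) /\
     is_channel (E0 S n l) /\
     (forall j, (j < n)%N -> is_channel (Emid S n l j)) /\
     is_channel (Eend S n l)).

Definition meanN k (S : setting k) : R := limn (series (fun n => n%:R * Omega S n) : nat -> R).

Fixpoint comb_stage k (S : setting k) (n l : nat) (V : nat -> 'M[C]_(2 ^ k)) (j : nat)
  : 'M[C]_(2 ^ k * mem S n l j * dY S n l) :=
  match j return 'M[C]_(2 ^ k * mem S n l j * dY S n l) with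
  | 0 => apply_chan [seq K *t (1%:M : 'M[C]_(dY S n l)) | K <- E0 S n l] (chi S n l)
  | j'.+1 =>
      let U := (V j'.+1 *t (1%:M : 'M[C]_(mem S n l j'))) *t (1%:M : 'M[C]_(dY S n l)) in
      apply_chan [seq K *t (1%:M : 'M[C]_(dY S n l)) | K <- Emid S n l j']
                 (U *m comb_stage S n l V j' *m adj U)
  end.

Definition comb_out k (S : setting k) (n l : nat) (V : nat -> 'M[C]_(2 ^ k))
  : 'M[C]_((2 ^ k) ^ W S n l * dY S n l) :=
  apply_chan [seq K *t (1%:M : 'M[C]_(dY S n l)) | K <- Eend S n l]
             (comb_stage S n l V n).

Definition p_accept k (S : setting k) (n l : nat) (V : nat -> 'M[C]_(2 ^ k)) : R :=
  @complex.Re R (\tr (mu S n l *m comb_out S n l V)).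

Definition avg_accept k (S : setting k) (V : nat -> nat -> 'M[C]_(2 ^ k)) : R :=
  limn (series (fun n => Omega S n *
          \sum_(1 <= l < n.+2) omega S n l * p_accept S n l (V n)) : nat -> R).

Definition pH k (S : setting k) : R := avg_accept S (T S).

Definition pD k (S : setting k) (left : bool) (al : R) : R :=
  avg_accept S (fun n i => if left then Aalpha k al *m T S n i
                           else T S n i *m Aalpha k al).

Definition rhoH k (S : setting k) : 'M[C]_(2 ^ k + 1) := out_state (pH S) (plusk k).

(* |+><+|^{(k-1)} (x) |+_alpha><+_alpha| = A_alpha |+><+|^{k} A_alpha^dagger *)
Definition rhoD k (S : setting k) (left : bool) (al : R) : 'M[C]_(2 ^ k + 1) :=
  out_state (pD S left al) (Aalpha k al *m plusk k *m adj (Aalpha k al)).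

End QuantumDefs.

(* Main.v *)
(* Write A_x for the phase attack and s = sin(x/2). As A_x = P + e^(ix) Q is
   affine in e^(ix), one has the exact chord identity
     A_x rho A_x^-1 - rho = s (A_y rho A_y^-1 - A_z rho A_z^-1),
   with y, z = x/2 +- pi/2, for every rho. Telescoping it through the n slots of
   the comb writes the difference of the attacked and honest final states as s
   times a difference of two positive operators of trace n, so the attack lowers
   the acceptance probability by at most n s, hence by N s on average. On the
   other side, testing the client's output with the chord projectors gives
   eps_D >= s p_D, and correctness gives p_H >= 1 - eps_H. Taking s = 1/(2N)
   concludes. *)

Require Import Defs.
From HB Require Import structures.
From mathcomp Require Import all_boot all_order all_algebra.
From mathcomp Require Import complex mxtens.
From mathcomp Require Import all_classical all_reals all_analysis.
From mathcomp Require Import ring lra.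
Import Order.TTheory GRing.Theory Num.Theory.
Import numFieldNormedType.Exports.
Local Open Scope ring_scope.

Set Implicit Arguments.
Unset Strict Implicit.
Unset Printing Implicit Defensive.

(** * Adjoints, unitaries and tensor products *)

Section Adjoint.
Variable R : realType.
Local Notation C := (complex R).

Lemma adj_mul m n p (A : 'M[C]_(m, n)) (B : 'M[C]_(n, p)) :
  adj (A *m B) = adj B *m adj A.
Proof. by rewrite /adj trmx_mul map_mxM. Qed.

Lemma adjK m n (A : 'M[C]_(m, n)) : adj (adj A) = A.
Proof. by apply/matrixP => i j; rewrite !mxE conjCK. Qed.

Lemma adj_add m n (A B : 'M[C]_(m, n)) : adj (A + B) = adj A + adj B.
Proof. by apply/matrixP => i j; rewrite !mxE rmorphD. Qed.

Lemma adj_opp m n (A : 'M[C]_(m, n)) : adj (- A) = - adj A.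
Proof. by apply/matrixP => i j; rewrite !mxE rmorphN. Qed.

Lemma adj_scale m n (c : C) (A : 'M[C]_(m, n)) : adj (c *: A) = Num.conj c *: adj A.
Proof. by apply/matrixP => i j; rewrite !mxE rmorphM. Qed.

Lemma adj_mx0 m n : adj (0 : 'M[C]_(m, n)) = 0.
Proof. by apply/matrixP => i j; rewrite !mxE conjC0. Qed.

Lemma adj_scalar n (c : C) : adj (c%:M : 'M[C]_n) = (Num.conj c)%:M.
Proof. by apply/matrixP => i j; rewrite !mxE rmorphMn /= eq_sym. Qed.

Lemma adj_mx1 n : adj (1%:M : 'M[C]_n) = 1%:M.
Proof. by rewrite adj_scalar conjC1. Qed.

Lemma adj_tens m n p q (A : 'M[C]_(m, n)) (B : 'M[C]_(p, q)) :
  adj (A *t B) = adj A *t adj B.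
Proof. by rewrite /adj trmx_tens map_mxT. Qed.

Lemma adj_block m1 m2 n1 n2 (A : 'M[C]_(m1, n1)) B D (E : 'M[C]_(m2, n2)) :
  adj (block_mx A B D E) = block_mx (adj A) (adj D) (adj B) (adj E).
Proof. by rewrite /adj tr_block_mx map_block_mx. Qed.

Lemma unitary_adj n (U : 'M[C]_n) : unitary U -> U *m adj U = 1%:M.
Proof. exact: mulmx1C. Qed.

Lemma unitary_mul n (U V : 'M[C]_n) : unitary U -> unitary V -> unitary (U *m V).
Proof.
by move=> hU hV; rewrite /unitary adj_mul mulmxA -(mulmxA _ (adj U)) hU mulmx1.
Qed.

Lemma tensmx11 m n : (1%:M : 'M[C]_m) *t (1%:M : 'M[C]_n) = 1%:M.
Proof.
apply/matrixP => i j; case: (mxtens_indexP i) => i1 i2; case: (mxtens_indexP j) => j1 j2.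
rewrite tensmxE !mxE (can_eq (@mxtens_indexK _ _)) xpair_eqE.
by do 2!case: eqP => //=; rewrite ?mulr1n ?mulr0n ?mulr1 ?mulr0 ?mul0r.
Qed.

Lemma tensmxDl m n p q (A B : 'M[C]_(m, n)) (D : 'M[C]_(p, q)) :
  (A + B) *t D = A *t D + B *t D.
Proof. by apply/matrixP => i j; rewrite !mxE mulrDl. Qed.

Lemma tensmxZl m n p q c (A : 'M[C]_(m, n)) (D : 'M[C]_(p, q)) :
  (c *: A) *t D = c *: (A *t D).
Proof. by apply/matrixP => i j; rewrite !mxE mulrA. Qed.

Lemma tensmxDr m n p q (A : 'M[C]_(m, n)) (B D : 'M[C]_(p, q)) :
  A *t (B + D) = A *t B + A *t D.
Proof. by apply/matrixP => i j; rewrite !mxE mulrDr. Qed.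

Lemma tensmxZr m n p q c (A : 'M[C]_(m, n)) (D : 'M[C]_(p, q)) :
  A *t (c *: D) = c *: (A *t D).
Proof. by apply/matrixP => i j; rewrite !mxE mulrCA. Qed.

Lemma tensmx_suml m n p q (Ks : seq 'M[C]_(m, n)) (D : 'M[C]_(p, q)) :
  (\sum_(K <- Ks) K) *t D = \sum_(K <- Ks) K *t D.
Proof.
by elim/big_rec2: _ => [|K x y _ <-]; rewrite ?tens0mx ?tensmxDl.
Qed.

Lemma mxtrace_tens m n (A : 'M[C]_m) (B : 'M[C]_n) : \tr (A *t B) = \tr A * \tr B.
Proof. by rewrite /mxtrace mulr_sum; apply: eq_bigr => i _; rewrite mxE. Qed.

Lemma unitary_tens1 m n (U : 'M[C]_m) :
  unitary U -> unitary (U *t (1%:M : 'M[C]_n)).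
Proof. by move=> hU; rewrite /unitary adj_tens adj_mx1 tensmx_mul hU mulmx1 tensmx11. Qed.

End Adjoint.

(** * Positive semidefinite matrices and the variational bound on the trace norm *)

Section Psd.
Variable R : realType.
Local Notation C := (complex R).

Lemma psd_add n (X Y : 'M[C]_n) : psd X -> psd Y -> psd (X + Y).
Proof.
move=> [hX pX] [hY pY]; split; first by rewrite adj_add hX hY.
by move=> v; rewrite mulmxDr mulmxDl mxE addr_ge0.
Qed.

Lemma psd0 n : psd (0 : 'M[C]_n).
Proof. by split=> [|v]; rewrite ?adj_mx0 // mulmx0 mul0mx mxE. Qed.

Lemma psd_conj m n (K : 'M[C]_(m, n)) (X : 'M[C]_n) :
  psd X -> psd (K *m X *m adj K).
Proof.
move=> [hX pX]; split; first by rewrite !adj_mul adjK hX mulmxA.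
by move=> v; have := pX (adj K *m v); rewrite adj_mul adjK !mulmxA.
Qed.

Lemma psd1 n : psd (1%:M : 'M[C]_n).
Proof.
split=> [|v]; first exact: adj_mx1.
rewrite mulmx1 mxE sumr_ge0 // => i _; rewrite !mxE mulrC; exact: mul_conjC_ge0.
Qed.

Lemma psd_diag_ge0 n (X : 'M[C]_n) i : psd X -> 0 <= X i i.
Proof.
case=> _ /(_ (delta_mx i 0)); rewrite -mulmxA -colE.
have -> : adj (delta_mx i 0 : 'cV[C]_n) = delta_mx 0 i.
  by apply/matrixP => a b; rewrite !mxE andbC rmorph_nat.
by rewrite -rowE !mxE.
Qed.

Lemma psd_projector n (X : 'M[C]_n) : adj X = X -> X *m X = X -> psd X.
Proof. by move=> hX iX; rewrite -iX -{2}hX -{1}(mulmx1 X); apply: psd_conj; exact: psd1. Qed.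

(** Each diagonal block is carried into the sum by a coordinate isometry, and conjugation preserves
    positivity. *)
Lemma psd_block n1 n2 (X : 'M[C]_n1) (Y : 'M[C]_n2) :
  psd X -> psd Y -> psd (block_mx X 0 0 Y).
Proof.
move=> pX pY.
have -> : block_mx X 0 0 Y =
    col_mx 1%:M 0 *m X *m adj (col_mx 1%:M 0)
    + col_mx 0 1%:M *m Y *m adj (col_mx 0 1%:M).
  rewrite /adj !tr_col_mx !map_row_mx.
  rewrite !mul_col_mx !mul0mx !mul1mx !mul_mx_row !trmx0 !map_mx0 !trmx1 !map_mx1.
  by rewrite !mulmx0 !mulmx1 add_col_mx addr0 add0r.
by apply: psd_add; apply: psd_conj.
Qed.

Lemma hermitian_spectral n (A : 'M[C]_n) : adj A = A ->
  exists2 P : 'M[C]_n, unitary P &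
  exists2 d : 'rV[C]_n, (forall i, d 0 i \is Num.real) &
    A = adj P *m diag_mx d *m P.
Proof.
move=> hA; have hermA : A \is hermsymmx.
  by apply/is_hermitianmxP; rewrite expr0 scale1r -[LHS]hA.
have /hermitian_normalmx /orthomx_spectralP A_eq := hermA.
have PU := spectral_unitarymx A.
(* [unitarymx] asserts P P^† = 1, [unitary] the opposite order. *)
exists (spectralmx A); first by apply: mulmx1C; apply/unitarymxP.
exists (spectral_diag A); last by rewrite {1}A_eq invmx_unitary.
by move=> i; have /mxOverP/(_ 0 i) := hermitian_spectral_diag_real hermA.
Qed.

Lemma trace_conj_diag n (P H : 'M[C]_n) (d : 'rV[C]_n) :
  \tr (H *m (adj P *m diag_mx d *m P)) = \sum_i d 0 i * (P *m H *m adj P) i i.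
Proof.
rewrite mulmxA mxtrace_mulC !mulmxA mul_mx_diag.
by apply: eq_bigr => i _; rewrite mxE mulrC.
Qed.

(** In an eigenbasis of [X] the trace becomes the sum of the eigenvalues of [X], each weighted by a
    diagonal entry of the conjugated [M]; all factors are nonnegative. *)
Lemma psd_trace_mul_ge0 n (M X : 'M[C]_n) : psd M -> psd X -> 0 <= \tr (M *m X).
Proof.
move=> pM pX; have [P uP [d _ X_eq]] := hermitian_spectral (proj1 pX).
have d_ge0 i : 0 <= d 0 i.
  have := psd_diag_ge0 i (psd_conj P pX).
  rewrite X_eq !mulmxA (unitary_adj uP) mul1mx -!mulmxA (unitary_adj uP) mulmx1.
  by rewrite mxE eqxx.
rewrite X_eq trace_conj_diag sumr_ge0 // => i _.
by rewrite mulr_ge0 // psd_diag_ge0 //; exact: psd_conj.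
Qed.

(** The eigenvalues of A^† A are the squares of the real [d 0 i], and the square root of a real
    square is its absolute value. *)
Lemma trnorm_hermitian n (P : 'M[C]_n) (d : 'rV[C]_n) : unitary P ->
  (forall i, d 0 i \is Num.real) ->
  trnorm (adj P *m diag_mx d *m P) = \sum_i `|d 0 i|.
Proof.
move=> uP d_real; set A := _ *m P.
have adjd : adj (diag_mx d) = diag_mx d.
  apply/matrixP => i j; rewrite !mxE rmorphMn /= (conj_Creal (d_real j)) eq_sym.
  by case: eqP => [->|].
have A2 : adj A *m A = adj P *m diag_mx (\row_i d 0 i ^+ 2) *m P.
  rewrite /A !adj_mul adjK adjd !mulmxA -(mulmxA _ P) (unitary_adj uP) mulmx1.
  rewrite -(mulmxA (adj P)) mul_diag_mx; congr (_ *m _ *m _).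
  apply/matrixP => i j; rewrite !mxE.
  by case: eqP => [->|]; rewrite ?mulr1n ?mulr0n ?mulr0 ?expr2.
have cp : char_poly (adj A *m A) = \prod_(z <- [seq d 0 i ^+ 2 | i <- enum 'I_n]) ('X - z%:P).
  rewrite A2 /char_poly.
  (* Since P^† P = 1, the characteristic matrix is itself conjugated by [P]; the determinants of P^†
     and [P] then cancel. *)
  have -> : char_poly_mx (adj P *m diag_mx (\row_i d 0 i ^+ 2) *m P) =
    map_mx polyC (adj P) *m char_poly_mx (diag_mx (\row_i d 0 i ^+ 2)) *m map_mx polyC P.
    rewrite /char_poly_mx mulmxBr mulmxBl !map_mxM; congr (_ - _).
    by rewrite mul_mx_scalar -scalemxAl -map_mxM uP map_mx1 scalemx1.
  rewrite !det_mulmx mulrAC -det_mulmx -map_mxM uP map_mx1 det1 mul1r.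
  rewrite -[\det _]/(char_poly _) char_poly_trig ?diag_mx_is_trig //.
  rewrite big_map big_enum; apply: eq_bigr => i _.
  by rewrite !mxE eqxx.
have [r r_eq] : {r | r = eigenvalues (adj A *m A)} by eexists.
rewrite /trnorm -r_eq.
(* The factorization fixes the chosen list of roots only up to order, which suffices for a sum. *)
have : perm_eq r [seq d 0 i ^+ 2 | i <- enum 'I_n].
  apply: prod_XsubC_eq; rewrite -cp r_eq /eigenvalues; case: closed_field_poly_normal => /= s.
  by rewrite (monicP (char_poly_monic _)) scale1r => <-.
move=> /(perm_big _) ->; rewrite big_map big_enum; apply: eq_bigr => i _.
rewrite -(real_normK (d_real i)); exact: sqrCK.
Qed.

(** The easy half of the duality between trace norm and operator norm: in an eigenbasis of [A], the
    diagonal entries of a test operator with -1 <= H <= 1 lie in [-1, 1]. Every lower bound on a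
    trace distance below comes from a choice of [H]. *)
Lemma trace_mul_le_trnorm n (A H : 'M[C]_n) : adj A = A ->
  psd (1%:M - H) -> psd (1%:M + H) -> \tr (H *m A) <= trnorm A.
Proof.
move=> hA pB pD; have [P uP [d d_real ->]] := hermitian_spectral hA.
rewrite trnorm_hermitian // trace_conj_diag; apply: ler_sum => i _.
have := psd_diag_ge0 i (psd_conj P pB); have := psd_diag_ge0 i (psd_conj P pD).
rewrite !(mulmxDr, mulmxDl, mulmxN, mulNmx) !mulmx1 (unitary_adj uP).
have addE (X Y : 'M[C]_n) : (X + Y) i i = X i i + Y i i by rewrite mxE.
have oppE (X : 'M[C]_n) : (- X) i i = - X i i by rewrite mxE.
have oneE : (1%:M : 'M[C]_n) i i = 1 by rewrite mxE eqxx.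
rewrite !addE oppE oneE; set h := (_ *m adj P) i i => hD hB.
have h_real : h \is Num.real.
  by rewrite -[h](addKr 1) realD ?rpredN ?real1 // ger0_real.
apply: le_trans (real_ler_norm (realM (d_real i) h_real)) _.
rewrite normrM ler_piMr // real_ler_norml //; apply/andP; split; last by rewrite -subr_ge0.
by rewrite lerNl -subr_ge0 opprK.
Qed.

End Psd.

(** * Kraus channels: ancillas, positivity, trace and linearity *)

Section Channel.
Variable R : realType.
Local Notation C := (complex R).

Lemma is_channel_tens1 a b c (Ks : seq 'M[C]_(b, a)) : is_channel Ks ->
  is_channel [seq K *t (1%:M : 'M[C]_c) | K <- Ks].
Proof.
move=> hKs; rewrite /is_channel big_map.
under eq_bigr do rewrite adj_tens adj_mx1 tensmx_mul mulmx1.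
by rewrite -(big_map (fun K => adj K *m K) predT (fun X => X *t 1%:M))
  -tensmx_suml big_map hKs tensmx11.
Qed.

Lemma apply_chan_psd a b (Ks : seq 'M[C]_(b, a)) X : psd X -> psd (apply_chan Ks X).
Proof.
move=> pX; rewrite /apply_chan; elim/big_ind: _ => [|A B|K _]; first exact: psd0.
- exact: psd_add.
- exact: psd_conj.
Qed.

Lemma apply_chan_trace a b (Ks : seq 'M[C]_(b, a)) X :
  is_channel Ks -> \tr (apply_chan Ks X) = \tr X.
Proof.
move=> hKs; rewrite /apply_chan raddf_sum /=.
under eq_bigr do rewrite mxtrace_mulC mulmxA.
by rewrite -raddf_sum /= -mulmx_suml hKs mul1mx.
Qed.

Lemma apply_chanB a b (Ks : seq 'M[C]_(b, a)) X Y :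
  apply_chan Ks (X - Y) = apply_chan Ks X - apply_chan Ks Y.
Proof.
by rewrite /apply_chan -sumrB; apply: eq_bigr => K _; rewrite mulmxBr mulmxBl.
Qed.

Lemma apply_chanZ a b (Ks : seq 'M[C]_(b, a)) c X :
  apply_chan Ks (c *: X) = c *: apply_chan Ks X.
Proof.
by rewrite /apply_chan scaler_sumr; apply: eq_bigr => K _; rewrite -scalemxAr -scalemxAl.
Qed.

Lemma unitary_conj_trace n (U X : 'M[C]_n) :
  unitary U -> \tr (U *m X *m adj U) = \tr X.
Proof. by move=> uU; rewrite mxtrace_mulC mulmxA uU mul1mx. Qed.

End Channel.

(** * The phase attack and the chord identity *)

Section Phase.
Variable R : realType.
Local Notation C := (complex R).

Definition cis (x : R) : C := Complex (cos x) (sin x).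

Lemma cis0 : cis 0 = 1.
Proof. by rewrite /cis cos0 sin0. Qed.

Lemma conj_cis x : Num.conj (cis x) = Complex (cos x) (- sin x).
Proof. by []. Qed.

Lemma cis_conj x : cis x * Num.conj (cis x) = 1.
Proof.
rewrite conj_cis; apply/eqP; rewrite eq_complex /=; apply/andP; split; apply/eqP.
  by rewrite mulrN opprK -!expr2 cos2Dsin2.
by ring.
Qed.

(** Both sides equal 2i sin(x/2) e^(ix/2), because e^(i pi/2) - e^(-i pi/2) = 2i. *)
Lemma cis_chord x :
  cis x - 1 = toC (sin (x / 2)) * (cis (x / 2 + pi / 2) - cis (x / 2 - pi / 2)).
Proof.
have -> : x = x / 2 + x / 2 by field.
set y := x / 2; rewrite -[in RHS]/y.
have -> : (y + y) / 2 = y by field.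
rewrite /cis /toC !(cosD, sinD, cosN, sinN) cos_pihalf sin_pihalf.
have c2 : cos y ^+ 2 = 1 - sin y ^+ 2 by rewrite cos2sin2.
apply/eqP; rewrite eq_complex /=; apply/andP; split; apply/eqP.
  by rewrite -[cos y * cos y]expr2 c2; ring.
by ring.
Qed.

(** Expanding the conjugation leaves a part independent of y, since |e^(iy)| = 1, plus one term
    linear in e^(iy) and one linear in its conjugate. The scalar chord identity and its conjugate,
    which share the real factor sin(x/2), handle these two terms. *)
Lemma conj_chord n (P Q X : 'M[C]_n) (x : R) (U := fun y => P + cis y *: Q) :
  U x *m X *m adj (U x) - U 0 *m X *m adj (U 0) =
  toC (sin (x / 2)) *:
    (U (x / 2 + pi / 2) *m X *m adj (U (x / 2 + pi / 2))
     - U (x / 2 - pi / 2) *m X *m adj (U (x / 2 - pi / 2))).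
Proof.
have UE y : U y *m X *m adj (U y) = P *m X *m adj P + Q *m X *m adj Q
    + (cis y *: (Q *m X *m adj P) + Num.conj (cis y) *: (P *m X *m adj Q)).
  rewrite /U adj_add adj_scale !(mulmxDl, mulmxDr) -!scalemxAl -!scalemxAr -?scalemxAl.
  by rewrite scalerA cis_conj scale1r; apply/matrixP => i j; rewrite !mxE; ring.
have ch := cis_chord x.
have chc : Num.conj (cis x) - 1 = toC (sin (x / 2)) *
    (Num.conj (cis (x / 2 + pi / 2)) - Num.conj (cis (x / 2 - pi / 2))).
  have -> : toC (sin (x / 2)) = Num.conj (toC (sin (x / 2))).
    by apply/eqP; rewrite eq_complex /= oppr0 !eqxx.
  by rewrite -rmorphB -rmorphM -ch rmorphB /= conjC1.
rewrite !UE cis0 conjC1; apply/matrixP => i j; rewrite !mxE.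
move/eqP: chc; rewrite subr_eq => /eqP ->; move/eqP: ch; rewrite subr_eq => /eqP ->.
by ring.
Qed.

Lemma phaseE (x : R) : phase x = delta_mx 0 0 + cis x *: delta_mx 1 1.
Proof.
apply/matrixP => i j; rewrite !mxE.
by case: (unliftP ord0 i) => [[[|//] hi]|] ->;
   case: (unliftP ord0 j) => [[[|//] hj]|] -> //=;
   rewrite ?mulr0 ?mulr1 ?addr0 ?add0r.
Qed.

Lemma Aalpha_affine k : exists P Q : 'M[C]_(2 ^ k),
  forall x, Aalpha k x = P + cis x *: Q.
Proof.
case: k => [|k]; first by exists 1%:M, 0 => x; rewrite scaler0 addr0.
exists (castmx (esym (expnSr 2 k), esym (expnSr 2 k)) (1%:M *t delta_mx 0 0)).
exists (castmx (esym (expnSr 2 k), esym (expnSr 2 k)) (1%:M *t delta_mx 1 1)).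
move=> x; rewrite /= phaseE tensmxDr tensmxZr.
by apply/matrixP => i j; rewrite !(castmxE, mxE).
Qed.

Lemma phase_unitary (x : R) : unitary (phase x).
Proof.
rewrite /unitary phaseE adj_add adj_scale.
have adj_delta (a : 'I_2) : adj (delta_mx a a : 'M[C]_2) = delta_mx a a.
  by apply/matrixP => i j; rewrite !mxE rmorph_nat andbC.
rewrite !adj_delta !(mulmxDl, mulmxDr) -!scalemxAl -!scalemxAr.
rewrite !mul_delta_mx !mul_delta_mx_0 // !scaler0 addr0 add0r scalerA mulrC cis_conj scale1r.
apply/matrixP => i j; rewrite !mxE.
by case: (unliftP ord0 i) => [[[|//] hi]|] ->;
   case: (unliftP ord0 j) => [[[|//] hj]|] -> //=; rewrite ?addr0 ?add0r.
Qed.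

Lemma unitary_cast m n (e : m = n) (U : 'M[C]_m) :
  unitary U -> unitary (castmx (e, e) U).
Proof. by case: n / e; rewrite castmx_id. Qed.

Lemma Aalpha_unitary k (x : R) : unitary (Aalpha k x).
Proof.
case: k => [|k]; first by rewrite /unitary adj_mx1 mulmx1.
apply: unitary_cast; rewrite /unitary adj_tens adj_mx1 tensmx_mul mulmx1.
by rewrite phase_unitary tensmx11.
Qed.

Lemma Aalpha0 k : Aalpha k 0 = 1%:M :> 'M[C]_(2 ^ k).
Proof.
case: k => [//|k] /=.
have -> : phase (0 : R) = 1%:M.
  rewrite phaseE cis0 scale1r; apply/matrixP => i j; rewrite !mxE.
  by case: (unliftP ord0 i) => [[[|//] hi]|] ->;
     case: (unliftP ord0 j) => [[[|//] hj]|] -> //=; rewrite ?addr0 ?add0r.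
rewrite tensmx11; case: _ / (esym _); exact: castmx_id.
Qed.

End Phase.

(** * One step of the telescoping argument *)

Section GapStep.
Variable R : realType.
Local Notation C := (complex R).

(* Replacing the step [U0] by [U] adds [s] times a difference of two states
   to the gap, and every later step maps states to states. *)
Lemma gap_step m p (Ks : seq 'M[C]_(p, m)) (U U0 U1 U2 rD rH X Y : 'M[C]_m) (s : C) :
  is_channel Ks -> unitary U -> unitary U1 -> unitary U2 ->
  psd rH -> psd X -> psd Y -> rD - rH = s *: (X - Y) ->
  U *m rH *m adj U - U0 *m rH *m adj U0
    = s *: (U1 *m rH *m adj U1 - U2 *m rH *m adj U2) ->
  exists X' Y', [/\ psd X', psd Y', \tr X' = \tr X + \tr rH, \tr Y' = \tr Y + \tr rH &
    apply_chan Ks (U *m rD *m adj U) - apply_chan Ks (U0 *m rH *m adj U0)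
    = s *: (X' - Y')].
Proof.
move=> chK uU uU1 uU2 pH pX pY gap chord.
exists (apply_chan Ks (U *m X *m adj U + U1 *m rH *m adj U1)).
exists (apply_chan Ks (U *m Y *m adj U + U2 *m rH *m adj U2)).
split.
- by apply/apply_chan_psd/psd_add; apply: psd_conj.
- by apply/apply_chan_psd/psd_add; apply: psd_conj.
- by rewrite apply_chan_trace // mxtraceD !unitary_conj_trace.
- by rewrite apply_chan_trace // mxtraceD !unitary_conj_trace.
rewrite -!apply_chanB -apply_chanZ; congr (apply_chan _ _).
(* Passing through U rH U^† splits the gap: replacing [U0] by [U] on the honest state is the new
   chord term, and the earlier gap is conjugated by [U]. *)
rewrite -[LHS](subrKA (U *m rH *m adj U)) chord -mulmxBl -mulmxBr gap.
rewrite -scalemxAr -scalemxAl -scalerDr mulmxBr mulmxBl.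
by congr (_ *: _); rewrite opprD addrACA.
Qed.

End GapStep.

(** * The attack inside the comb: states, telescoping and acceptance for fixed [n] and [l] *)

Section Comb.
Variables (R : realType) (k : nat) (S : setting R k) (n l : nat).
Local Notation C := (complex R).
Hypothesis hS : valid_setting S.
Hypothesis hl : (1 <= l <= n.+1)%N.

Let hnl := (proj2 (proj2 (proj2 (proj2 (proj2 (proj2 hS)))))) n l hl.

Let E0_channel : is_channel (E0 S n l). Proof. by case: hnl => _ [_ [_ []]]. Qed.
Let Emid_channel j : (j < n)%N -> is_channel (Emid S n l j).
Proof. by case: hnl => _ [_ [_ [_ [+ _]]]]; apply. Qed.
Let Eend_channel : is_channel (Eend S n l). Proof. by case: hnl => _ [_ [_ [_ []]]]. Qed.

(** This is the local unitary of [comb_stage], named so that the affine form of the attack can be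
    stated for it. *)
Definition slot (V : 'M[C]_(2 ^ k)) j :=
  (V *t (1%:M : 'M[C]_(Defs.mem S n l j))) *t (1%:M : 'M[C]_(dY S n l)).

Lemma slot_unitary V j : unitary V -> unitary (slot V j).
Proof. by move=> uV; do 2!apply: unitary_tens1. Qed.

Lemma comb_stage_density V j : (j <= n)%N ->
  (forall i, (1 <= i <= n)%N -> unitary (V i)) -> density (comb_stage S n l V j).
Proof.
move=> + uV; elim: j => [_|j IH jn] /=.
  have [pX tX] := proj1 hnl; split; first exact: apply_chan_psd.
  by rewrite apply_chan_trace //; exact: is_channel_tens1.
have [pX tX] := IH (ltnW jn); split; first exact/apply_chan_psd/psd_conj.
rewrite apply_chan_trace; last exact/is_channel_tens1/Emid_channel.
by rewrite unitary_conj_trace //; apply: slot_unitary; apply: uV.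
Qed.

Lemma comb_out_density V :
  (forall i, (1 <= i <= n)%N -> unitary (V i)) -> density (comb_out S n l V).
Proof.
move=> uV; have [pX tX] := comb_stage_density (leqnn n) uV.
split; first exact: apply_chan_psd.
by rewrite apply_chan_trace //; exact: is_channel_tens1.
Qed.

Definition attacked (left : bool) (x : R) i :=
  if left then Aalpha k x *m T S n i else T S n i *m Aalpha k x.

Lemma attacked_unitary left x i : (1 <= i <= n)%N -> unitary (attacked left x i).
Proof.
move=> hi; have uT : unitary (T S n i) by case: hS => _ [_ [_ [_ [_ [+ _]]]]]; apply.
rewrite /attacked; case: left; apply: unitary_mul => //; exact: Aalpha_unitary.
Qed.

(** Multiplying by a test unitary on either side and tensoring with identities are linear, so the
    affine dependence of [Aalpha] on e^(ix) survives. This makes [conj_chord] applicable to a slot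
    for both placements. *)
Lemma slot_attacked_affine left i j : exists P Q,
  forall x, slot (attacked left x i) j = P + cis x *: Q.
Proof.
have [P [Q PQ]] := Aalpha_affine R k.
pose mulT X := if left then X *m T S n i else T S n i *m X.
exists (slot (mulT P) j), (slot (mulT Q) j) => x; rewrite /slot -!tensmxZl -!tensmxDl.
congr (_ *t _ *t _); rewrite /attacked /mulT PQ; case: (left).
  by rewrite mulmxDl scalemxAl.
by rewrite mulmxDr scalemxAr.
Qed.

(** Induction with [gap_step]: the two runs start in the same state, so X = Y = 0, and each slot
    raises both traces by the trace 1 of the honest state. *)
Lemma comb_stage_gap left x j : (j <= n)%N ->
  exists X Y, [/\ psd X, psd Y, \tr X = j%:R, \tr Y = j%:R &
    comb_stage S n l (attacked left x) j - comb_stage S n l (T S n) j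
    = toC (sin (x / 2)) *: (X - Y)].
Proof.
elim: j => [_|j IH jn].
  by exists 0, 0; rewrite linear0 subrr subr0 scaler0; split => //; exact: psd0.
have [X [Y [pX pY tX tY XY]]] := IH (ltnW jn).
have uT i : (1 <= i <= n)%N -> unitary (T S n i).
  by case: hS => _ [_ [_ [_ [_ [+ _]]]]]; apply.
have [pH tH] := comb_stage_density (ltnW jn) uT.
have [P [Q PQ]] := slot_attacked_affine left j.+1 j.
have uPQ y : unitary (P + cis y *: Q).
  by rewrite -PQ; exact/slot_unitary/attacked_unitary.
(* The honest slot is the attacked one at angle 0, so the chord identity compares the two. *)
have slot0 : slot (T S n j.+1) j = P + cis 0 *: Q.
  by rewrite -PQ /attacked Aalpha0 mul1mx mulmx1; case: (left).
have chE : is_channel [seq K *t (1%:M : 'M[C]_(dY S n l)) | K <- Emid S n l j].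
  exact/is_channel_tens1/Emid_channel.
(* The chord identity fixes the two open angles as x/2 + pi/2 and x/2 - pi/2. *)
have [X' [Y' [pX' pY' tX' tY' XY']]] := gap_step chE (uPQ x) (uPQ _) (uPQ _) pH pX pY XY
  (conj_chord _ _ _ _).
exists X', Y'; split; [exact: pX' | exact: pY' | | | by rewrite -XY' -PQ -slot0].
  by rewrite tX' tX tH natr1.
by rewrite tY' tY tH natr1.
Qed.

(** The traces of [X] against [mu] and against 1 - [mu] are both nonnegative and add up to [t]. *)
Lemma Re_trace_mu_bounds X (t : R) : psd X -> \tr X = toC t ->
  0 <= complex.Re (\tr (mu S n l *m X)) <= t.
Proof.
move=> pX tX; have [_ [pmu [pmuC _]]] := hnl.
have := psd_trace_mul_ge0 pmu pX; have := psd_trace_mul_ge0 pmuC pX.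
rewrite mulmxBl mul1mx linearB /= tX; case: (\tr _) => a b.
by rewrite !lecE /= subr_ge0 => /andP[_ ->] /andP[_ ->].
Qed.

Lemma p_accept_bounds V : (forall i, (1 <= i <= n)%N -> unitary (V i)) ->
  0 <= p_accept S n l V <= 1.
Proof. by move=> /comb_out_density[pX tX]; exact: Re_trace_mu_bounds. Qed.

(** The change in acceptance is s times tr(mu X) - tr(mu Y), where the images of [X] and [Y] under
    the last channel are positive of trace n. The first trace is at least 0 and the second at most
    n. *)
Lemma p_accept_gap left x : 0 <= sin (x / 2) ->
  p_accept S n l (T S n) - n%:R * sin (x / 2) <= p_accept S n l (attacked left x).
Proof.
move=> s0; have [X [Y [pX pY tX tY XY]]] := comb_stage_gap left x (leqnn n).
pose step Z := apply_chan [seq K *t (1%:M : 'M[C]_(dY S n l)) | K <- Eend S n l] Z.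
have tr_step Z : \tr (step Z) = \tr Z.
  by apply: apply_chan_trace; exact/is_channel_tens1.
have natC : n%:R = toC n%:R :> C := esym (rmorph_nat (real_complex R) n).
have /andP[a0 _] := Re_trace_mu_bounds (apply_chan_psd _ pX) (etrans (tr_step X) (etrans tX natC)).
have /andP[_ b1] := Re_trace_mu_bounds (apply_chan_psd _ pY) (etrans (tr_step Y) (etrans tY natC)).
have gap : comb_out S n l (attacked left x) =
    comb_out S n l (T S n) + toC (sin (x / 2)) *: (step X - step Y).
  by rewrite -apply_chanB -apply_chanZ -XY apply_chanB addrC subrK.
rewrite /p_accept gap mulmxDr -scalemxAr mulmxBr mxtraceD mxtraceZ linearB /=.
move: a0 b1; rewrite -/(step X) -/(step Y).
case: (\tr _) => h h'; case: (\tr _) => a a'; case: (\tr _) => b b' /= a0 b1.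
rewrite mul0r subr0 lerD2l -mulNr mulrC; apply: ler_wpM2l => //; lra.
Qed.

End Comb.

(** * The client's output: the projectors on the plus state and on its rotations *)

Section OutputStates.
Variable R : realType.
Local Notation C := (complex R).

Lemma toCE (x : R) : toC x = real_complex R x. Proof. by []. Qed.

Lemma castmx_const m n m' n' (e : (m = m') * (n = n')) (c : C) :
  castmx e (const_mx c) = const_mx c.
Proof. by apply/matrixP => i j; rewrite castmxE !mxE. Qed.

Lemma tens_const m n p q (c d : C) :
  (const_mx c : 'M[C]_(m, n)) *t (const_mx d : 'M[C]_(p, q)) = const_mx (c * d).
Proof. by apply/matrixP => i j; rewrite !mxE. Qed.

Lemma plusk_const k : (1 <= k)%N -> plusk R k = const_mx ((2 ^ k)%:R^-1).
Proof.
case: k => // k _; rewrite /plusk.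
have toC_half : toC (1 / 2 : R) = 2^-1.
  by rewrite toCE div1r fmorphV rmorph_nat.
elim: k => [|k IH]; first by rewrite /plus1 toC_half.
rewrite ntensmxSS IH tens_const toC_half; congr const_mx.
by rewrite [in RHS]expnS natrM invfM.
Qed.

Lemma adj_const m n (c : C) : adj (const_mx c : 'M[C]_(m, n)) = const_mx (Num.conj c).
Proof. by apply/matrixP => i j; rewrite !mxE. Qed.

Lemma mxtrace_const n (c : C) : \tr (const_mx c : 'M[C]_n) = c * n%:R.
Proof.
rewrite /mxtrace (eq_bigr (fun=> c)) => [|i _]; last by rewrite mxE.
by rewrite sumr_const card_ord mulr_natr.
Qed.

(** With J the all-ones matrix, J A J is J times the sum of the entries of [A], and this sum is tr(J
    A). *)
Lemma const_mul_const n (c d : C) (A : 'M[C]_n) :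
  const_mx c *m A *m const_mx d = const_mx (c * d * \tr (const_mx 1 *m A)) :> 'M[C]_n.
Proof.
apply/matrixP => i j; rewrite !mxE /mxtrace mulr_sumr; apply: eq_bigr => b _.
rewrite !mxE mulr_suml mulr_sumr; apply: eq_bigr => a _; rewrite !mxE; ring.
Qed.

(** The all-ones matrix factors over the tensor product: the first k qubits contribute 2^k, the
    phase gate 1 + e^(ix). *)
Lemma trace_const_Aalpha k (x : R) :
  \tr (const_mx 1 *m Aalpha k.+1 x) = (2 ^ k)%:R * (1 + cis x).
Proof.
rewrite /Aalpha -(castmx_const (esym (expnSr 2 k), esym (expnSr 2 k)) 1).
have -> : const_mx 1 = const_mx 1 *t const_mx 1 :> 'M[C]_(2 ^ k * 2).
  by rewrite tens_const mulr1.
have cast_mul m n (e : m = n) (A B : 'M[C]_m) :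
    \tr (castmx (e, e) A *m castmx (e, e) B) = \tr (A *m B).
  by case: n / e; rewrite !castmx_id.
rewrite cast_mul tensmx_mul mxtrace_tens mulmx1 mxtrace_const mul1r; congr (_ * _).
rewrite phaseE /mxtrace !big_ord_recl !big_ord0 !mxE !big_ord_recl !big_ord0 !mxE /=.
by ring.
Qed.

Lemma plusk_adj k : (1 <= k)%N -> adj (plusk R k) = plusk R k.
Proof. by move=> k1; rewrite plusk_const // adj_const fmorphV /= conjC_nat. Qed.

Lemma plusk_idem k : (1 <= k)%N -> plusk R k *m plusk R k = plusk R k.
Proof.
move=> k1; have n0 : (2 ^ k)%:R != 0 :> C by rewrite pnatr_eq0 expn_eq0.
rewrite plusk_const // -{1}[const_mx _]mulmx1 const_mul_const mulmx1 mxtrace_const.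
by rewrite mul1r mulfVK.
Qed.

Lemma plusk_trace k : (1 <= k)%N -> \tr (plusk R k) = 1.
Proof.
move=> k1; have n0 : (2 ^ k)%:R != 0 :> C by rewrite pnatr_eq0 expn_eq0.
by rewrite plusk_const // mxtrace_const mulVf.
Qed.

Definition rotated_plus k (x : R) := Aalpha k x *m plusk R k *m adj (Aalpha k x).

Lemma rotated_plus_adj k x : (1 <= k)%N -> adj (rotated_plus k x) = rotated_plus k x.
Proof. by move=> k1; rewrite /rotated_plus !adj_mul adjK plusk_adj // mulmxA. Qed.

Lemma rotated_plus_idem k x : (1 <= k)%N ->
  rotated_plus k x *m rotated_plus k x = rotated_plus k x.
Proof.
move=> k1; rewrite /rotated_plus !mulmxA -(mulmxA _ (adj _)) Aalpha_unitary mulmx1.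
by rewrite -(mulmxA _ (plusk R k) (plusk R k)) plusk_idem.
Qed.

Lemma rotated_plus_trace k x : (1 <= k)%N -> \tr (rotated_plus k x) = 1.
Proof. by move=> k1; rewrite unitary_conj_trace ?plusk_trace //; exact: Aalpha_unitary. Qed.

Lemma rotated_plus0 k : rotated_plus k 0 = plusk R k.
Proof. by rewrite /rotated_plus Aalpha0 adj_mx1 mul1mx mulmx1. Qed.

(** The overlap is |1 + e^(ix)|^2 / 4 = cos^2(x/2). *)
Lemma rotated_plus_overlap k x : (1 <= k)%N ->
  \tr (plusk R k *m rotated_plus k x) = toC (1 - sin (x / 2) ^+ 2).
Proof.
move=> k1; rewrite /rotated_plus !mulmxA plusk_const //.
rewrite const_mul_const.
have constZ (c : C) : const_mx c = c *: const_mx 1 :> 'M[C]_(2 ^ k).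
  by apply/matrixP => i j; rewrite !mxE mulr1.
have trJ : \tr (const_mx 1 *m adj (Aalpha k x)) = Num.conj (\tr (const_mx 1 *m Aalpha k x)).
  rewrite [RHS](_ : _ = \tr (adj (const_mx 1 *m Aalpha k x))).
    by rewrite adj_mul adj_const conjC1 mxtrace_mulC.
  by rewrite /mxtrace rmorph_sum; apply: eq_bigr => i _; rewrite !mxE.
rewrite constZ -scalemxAl mxtraceZ trJ; case: k k1 {constZ trJ} => // k _.
rewrite trace_const_Aalpha rmorphM rmorphD /= conjC1 conjC_nat expnS natrM.
have n0 : (2 ^ k)%:R != 0 :> C by rewrite pnatr_eq0 expn_eq0.
have <- : (1 + cis x) * (1 + Num.conj (cis x)) / 4 = toC (1 - sin (x / 2) ^+ 2).
  have x2 : x = x / 2 + x / 2 by field.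
  have cx : cos x = 1 - 2 * sin (x / 2) ^+ 2.
    by rewrite {1}x2 cosD -!expr2 cos2sin2; ring.
  have -> : (1 + cis x) * (1 + Num.conj (cis x)) = 2 + (cis x + Num.conj (cis x)).
    by rewrite mulrDl mul1r mulrDr mulr1 cis_conj; ring.
  have -> : cis x + Num.conj (cis x) = toC (2 * cos x).
    by rewrite conj_cis; apply/eqP; rewrite eq_complex /= subrr eqxx andbT; apply/eqP; ring.
  by rewrite cx !toCE !(rmorphM, rmorphB, rmorphXn, rmorph_nat, rmorph1); field.
by field.
Qed.

Lemma rotated_plus_chord k x : rotated_plus k x - plusk R k =
  toC (sin (x / 2)) *: (rotated_plus k (x / 2 + pi / 2) - rotated_plus k (x / 2 - pi / 2)).
Proof.
have [P [Q PQ]] := Aalpha_affine R k.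
rewrite -(rotated_plus0 k) /rotated_plus !PQ; exact: conj_chord.
Qed.

End OutputStates.

(** * Lower bounds on trace distances between client outputs *)

Section TraceNormBounds.
Variable R : realType.
Local Notation C := (complex R).

Lemma psd_scalar n (c : R) : 0 <= c -> psd ((toC c)%:M : 'M[C]_n).
Proof.
move=> c0; split; first by rewrite adj_scalar conj_Creal // ger0_real // ler0c.
move=> v; rewrite mul_mx_scalar -scalemxAl mxE mulr_ge0 ?ler0c //.
by have [_ /(_ v)] := psd1 R n; rewrite mulmx1.
Qed.

Lemma psd_projectorC n (X : 'M[C]_n) : adj X = X -> X *m X = X -> psd (1%:M - X).
Proof.
move=> hX iX; apply: psd_projector; first by rewrite adj_add adj_opp adj_mx1 hX.
by rewrite mulmxBl mul1mx mulmxBr mulmx1 iX subrr subr0.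
Qed.

Lemma toC_adj n (c : R) (X : 'M[C]_n) : adj X = X -> adj (toC c *: X) = toC c *: X.
Proof.
move=> hX; rewrite adj_scale hX; congr (_ *: _).
by apply/eqP; rewrite eq_complex /= oppr0 !eqxx.
Qed.

(** The left side is the expectation of the block-diagonal test with [H] on the computation space
    and [h] on the reject flag; this test lies between -1 and 1. *)
Lemma trnorm_out_state_ge k (a b h : R) (X Y H : 'M[C]_(2 ^ k)) :
  adj X = X -> adj Y = Y -> -1 <= h <= 1 -> psd (1%:M - H) -> psd (1%:M + H) ->
  toC a * \tr (H *m X) - toC b * \tr (H *m Y) + toC (h * (b - a))
  <= trnorm (out_state a X - out_state b Y).
Proof.
move=> hX hY /andP[h1 h2] pB pD.
have AE : out_state a X - out_state b Y =
    block_mx (toC a *: X - toC b *: Y) 0 0 ((toC (b - a))%:M).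
  rewrite /out_state opp_block_mx add_block_mx !subr0; congr block_mx.
  have -> : b - a = (1 - a) - (1 - b) by ring.
  by rewrite [toC (_ - (_ - _))](rmorphB (real_complex R)) [RHS]raddfB.
pose K := block_mx H 0 0 ((toC h)%:M : 'M[C]_1).
have one_block : 1%:M = block_mx 1%:M 0 0 1%:M :> 'M[C]_(2 ^ k + 1).
  exact: scalar_mx_block.
have toC1 : 1%:M = (toC 1)%:M :> 'M[C]_1 by [].
have -> : toC a * \tr (H *m X) - toC b * \tr (H *m Y) + toC (h * (b - a)) =
    \tr (K *m (out_state a X - out_state b Y)).
  rewrite AE mulmx_block !mulmx0 !mul0mx !addr0 !add0r mxtrace_block.
  rewrite mulmxBr -!scalemxAr linearB /= !mxtraceZ; congr (_ + _).
  by rewrite -scalar_mxM mxtrace_scalar mulr1n !toCE -rmorphM.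
apply: trace_mul_le_trnorm.
- rewrite AE adj_block !adj_mx0 adj_add adj_opp !toC_adj // adj_scalar.
  by congr block_mx; rewrite conj_Creal //; apply/complex_realP; eexists.
- rewrite one_block opp_block_mx add_block_mx !subr0 toC1 -raddfB /=.
  by apply: psd_block => //; rewrite !toCE -rmorphB; apply: psd_scalar; rewrite subr_ge0.
- rewrite one_block add_block_mx !addr0 toC1 -raddfD /=.
  apply: psd_block => //; rewrite !toCE -rmorphD; apply: psd_scalar.
  by rewrite -lerBlDl sub0r.
Qed.

Lemma psd_rotated_plus k (x : R) : (1 <= k)%N -> psd (rotated_plus k x).
Proof. by move=> k1; apply: psd_projector; rewrite ?rotated_plus_adj ?rotated_plus_idem. Qed.

Lemma psd_rotated_plusC k (x : R) : (1 <= k)%N -> psd (1%:M - rotated_plus k x).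
Proof. by move=> k1; apply: psd_projectorC; rewrite ?rotated_plus_adj ?rotated_plus_idem. Qed.

(** Testing with minus the plus projector and weight 1 on the reject flag gives -p + 1 + (1 - p). *)
Lemma trnorm_reject_ge k (p : R) : (1 <= k)%N ->
  toC (2 * (1 - p)) <= trnorm (out_state p (plusk R k) - out_state 1 (plusk R k)).
Proof.
move=> k1; rewrite -rotated_plus0; set s := rotated_plus k 0.
have hs : adj s = s by exact: rotated_plus_adj.
apply: le_trans (trnorm_out_state_ge (h := 1) (H := - s) _ _ _ _ _ _ _) => //.
- rewrite mulNmx rotated_plus_idem // linearN /= rotated_plus_trace // !toCE.
  rewrite -[X in X <= _]addr0 -subr_ge0 !(rmorphM, rmorphB, rmorph1, rmorph_nat).
  by rewrite le_eqVlt; apply/orP; left; apply/eqP; ring.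
- by rewrite lexx andbT; lra.
- by rewrite opprK; apply: psd_add; [exact: psd1 | exact: psd_rotated_plus].
- exact: psd_rotated_plusC.
Qed.

(* The optimal test: the difference of the two projectors of the chord
   identity on X, and the weight -sin(x/2) on the reject flag, which cancels
   the dependence on [p]. *)
Lemma trnorm_rotated_ge k (a p x : R) : (1 <= k)%N -> 0 < sin (x / 2) ->
  toC (2 * (a * sin (x / 2))) <=
  trnorm (out_state a (rotated_plus k x) - out_state p (plusk R k)).
Proof.
move=> k1 s0; set s := sin (x / 2) in s0 *.
have chord := rotated_plus_chord k x; rewrite -/s in chord.
pose H := rotated_plus k (x / 2 + pi / 2) - rotated_plus k (x / 2 - pi / 2).
have sC0 : toC s != 0 by rewrite eq_complex /= eqxx andbT gt_eqF.
have ov := rotated_plus_overlap x k1; rewrite -/s in ov.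
(* Multiplied by s, the chord identity turns this into 1 - (1 - s^2) = s^2, and s is cancelled;
   [trHY] has the opposite sign. *)
have trHX : \tr (H *m rotated_plus k x) = toC s.
  apply: (mulfI sC0); rewrite -mxtraceZ scalemxAl -chord mulmxBl linearB /=.
  rewrite rotated_plus_idem // rotated_plus_trace // ov !toCE.
  by rewrite rmorphB rmorphXn rmorph1; ring.
have trHY : \tr (H *m plusk R k) = - toC s.
  apply: (mulfI sC0); rewrite -mxtraceZ scalemxAl -chord mulmxBl linearB /=.
  rewrite plusk_idem // plusk_trace // mxtrace_mulC ov !toCE.
  by rewrite rmorphB rmorphXn rmorph1; ring.
apply: le_trans (trnorm_out_state_ge (h := - s) (H := H) _ _ _ _ _ _ _).
(* The test value is a s + p s - s (p - a) = 2 a s. *)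
- rewrite trHX trHY !toCE.
  rewrite le_eqVlt; apply/orP; left; apply/eqP.
  by rewrite !(rmorphM, rmorphB, rmorphN, rmorph_nat) /=; ring.
- exact: rotated_plus_adj.
- exact: plusk_adj.
- by rewrite lerNl opprK sin_le1 /= (le_trans _ ler01) // oppr_le0 ltW.
(* With H a difference of projectors E - F, 1 - H = (1 - E) + F; similarly 1 + H = E + (1 - F). *)
- by rewrite /H opprB addrCA addrC; apply: psd_add;
    [exact: psd_rotated_plusC | exact: psd_rotated_plus].
- by rewrite /H addrCA; apply: psd_add;
    [exact: psd_rotated_plus | exact: psd_rotated_plusC].
Qed.

End TraceNormBounds.

(** * Averaging over the random number of test rounds and the output round *)

Lemma lim_series_subZ_le (R : realType) (f g h : R ^nat) (s : R) :
  cvgn (series f) -> cvgn (series g) -> cvgn (series h) ->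
  (forall n, f n - s * h n <= g n) ->
  limn (series f) - s * limn (series h) <= limn (series g).
Proof.
move=> cf cg ch fg; have cs : cvgn (series (s *: h)) by exact: is_cvg_seriesZ.
have -> : s * limn (series h) = limn (series (s *: h)) by rewrite lim_seriesZ.
rewrite -lim_seriesB //; apply: lim_series_le => //; exact: is_cvg_seriesB.
Qed.

Section AverageAcceptance.
Variables (R : realType) (k : nat) (S : setting R k).
Hypothesis hS : valid_setting S.

Lemma accept_term_bounds n V : (forall i, (1 <= i <= n)%N -> unitary (V i)) ->
  0 <= \sum_(1 <= l < n.+2) omega S n l * p_accept S n l V <= 1.
Proof.
move=> uV; have [_ [_ [_ [_ [/(_ n)[w0 w1] _]]]]] := hS.
apply/andP; split.
  rewrite big_nat sumr_ge0 // => l hl; rewrite mulr_ge0 ?w0 //.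
  by have /andP[] := p_accept_bounds hS hl uV.
rewrite -w1 big_nat [leRHS]big_nat; apply: ler_sum => l hl.
by rewrite ler_piMr ?w0 //; have /andP[] := p_accept_bounds hS hl uV.
Qed.

(** Comparison with the convergent series of [Omega]. Convergence is what gives the [limn] in
    [avg_accept] its meaning as a sum. *)
Lemma avg_accept_cvg V : (forall n i, (1 <= i <= n)%N -> unitary (V n i)) ->
  cvgn (series (fun n => Omega S n *
          \sum_(1 <= l < n.+2) omega S n l * p_accept S n l (V n)) : nat -> R).
Proof.
move=> uV; have [pos [cvgO _]] := hS.
apply: series_le_cvg cvgO => // n; have /andP[t0 t1] := accept_term_bounds (uV n).
  by rewrite mulr_ge0.
by rewrite ler_piMr.
Qed.

Lemma pD_ge left x : 0 <= sin (x / 2) -> pH S - sin (x / 2) * meanN S <= pD S left x.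
Proof.
move=> s0; have [pos [_ [_ [cN [hw [uT _]]]]]] := hS.
have cH := avg_accept_cvg uT.
have cD := avg_accept_cvg (fun n i => @attacked_unitary _ _ _ n hS left x i).
apply: (lim_series_subZ_le cH cD cN) => n; have [w0 w1] := hw n.
(* As the weights [omega] sum to 1, the loss n s can be moved inside the average over [l], where the
   bound for fixed [l] applies. *)
rewrite [leLHS](_ : _ = Omega S n * (\sum_(1 <= l < n.+2)
    omega S n l * (p_accept S n l (T S n) - n%:R * sin (x / 2)))).
  rewrite ler_wpM2l // big_nat [leRHS]big_nat; apply: ler_sum => l hl.
  by rewrite ler_wpM2l ?w0 //; exact: p_accept_gap.
under [in RHS]eq_bigr do rewrite mulrBr.
rewrite sumrB -mulr_suml w1 mul1r mulrBr; congr (_ - _).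
by rewrite [LHS]mulrC -[LHS]mulrA [LHS]mulrCA.
Qed.

End AverageAcceptance.

Theorem mainTheorem5 (R : realType) (k : nat) (S : setting R k) (left : bool)
    (epsH epsD : R) :
  (1 <= k)%N ->
  valid_setting S ->
  1 <= meanN S ->
  0 <= epsH -> 0 <= epsD ->
  trnorm (rhoH S - out_state 1 (plusk R k)) / 2 <= toC epsH ->
  (forall al : R, exists2 p : R, 0 <= p <= 1 &
     trnorm (rhoD S left al - out_state p (plusk R k)) / 2 <= toC epsD) ->
  1 / (4 * meanN S) <= epsH + epsD.
Proof.
move=> k1 hS N1 eH0 eD0 hH hD; set N := meanN S in N1 *.
(* Turns the complex-valued trace-distance hypotheses into real inequalities. *)
have half_le (t e : R) z : toC (2 * t) <= z -> z / 2 <= toC e -> t <= e.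
  move=> tz ze; rewrite -(@lecR R); apply: le_trans ze.
  by rewrite ler_pdivlMr // -[X in _ * X](rmorph_nat (real_complex R)) -rmorphM mulrC.
have rejH : 1 - pH S <= epsH := half_le _ _ _ (trnorm_reject_ge _ k1) hH.
have N0 : 0 < N by apply: lt_le_trans N1.
(* This value maximizes s (1 - s N), with maximum 1/(4N). *)
pose s := (2 * N)^-1.
have s0 : 0 < s by rewrite invr_gt0 mulr_gt0.
have sN : s * N = 2^-1 by rewrite /s; field; rewrite gt_eqF.
(* Here N >= 1 enters: it puts s in the domain of the arcsine, and also gives s epsH <= epsH at the
   end. *)
have s_half : s <= 2^-1 by rewrite -sN ler_peMr // ltW.
have sinE : sin (asin s * 2 / 2) = s.
  by rewrite mulfK // asinK // in_itv /=; apply/andP; split; lra.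
(* The attack angle is twice the arcsine, as the bounds involve the sine of the half angle. *)
have [p _ hp] := hD (asin s * 2).
have gapD := pD_ge hS left (x := asin s * 2); rewrite sinE -/N sN in gapD.
have sin0 : 0 < sin (asin s * 2 / 2) by rewrite sinE.
have detD := half_le _ _ _ (trnorm_rotated_ge (pD S left (asin s * 2)) p k1 sin0) hp.
rewrite sinE in detD.
have -> : 1 / (4 * N) = s / 2 by rewrite /s; field; rewrite gt_eqF.
(* Chaining gives epsD >= s pD >= s (1 - epsH - 1/2) >= s/2 - epsH. *)
have := gapD (ltW s0); nra.
Qed.
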